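(* Let $\mathbb{K}\in\{\mathbb{R},\mathbb{C}\}$, let $(\Omega,\Sigma,\mu)$ be a positive measure space and let $\bm{\varphi}:\Omega\to\mathbb{K}^n$ be a $\mu$-frame for $\mathbb{K}^n$; write $\bm{\varphi}_x:=\bm{\varphi}(x)$. Then $\bm{\varphi}$ is discretely scalable if and only if one of the following (mutually equivalent) conditions holds: (i) $\bm{I}_n\in\operatorname{cone}\{\bm{\varphi}_x\bm{\varphi}_x^\ast: x\in\Omega\}$. (ii) There exists a positive measure $\nu$ on $\Omega$ such that $\bm{\varphi}\in L_2(\Omega,\nu;\mathbb{K}^n)$ and $\bm{\varphi}$ is a Parseval $\nu$-frame for $\mathbb{K}^n$. (iii) There exist $N\le\dim_{\mathbb{K}}\operatorname{lin}_{\mathbb{K}}\{\bm{\varphi}_x\bm{\varphi}_x^\ast: x\in\Omega\}$, points $x_1,\ldots,x_N\in\Omega$ and weights $\mu_1,\ldots,\mu_N>0$ such that $\bm{\varphi}$ is a Parseval $\widehat{\mu}$-frame with respect to the discrete measure $\widehat{\mu}=\sum_{j=1}^N\mu_j\delta_{x_j}$.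
   Context: $\bm{I}_n$ is the $n\times n$ identity matrix, $\bm{v}^\ast=\overline{\bm{v}}^\top$, $\operatorname{lin}_{\mathbb{K}}$ is the $\mathbb{K}$-linear span, and $\operatorname{cone}M:=\{\sum_{j=1}^m\lambda_jv_j: v_j\in M,\ \lambda_j\ge0,\ m\in\mathbb{N}\}$. For a positive measure space $(\Omega,\Sigma,\mu)$ (measure with values in $[0,\infty]$; in (ii) the measure $\nu$ may live on its own $\sigma$-algebra), a measurable function $\bm{\varphi}:\Omega\to\mathbb{K}^n$ is a $\mu$-frame for $\mathbb{K}^n$ if there are constants $0<A\le B<\infty$ with $$A\|f\|^2\le\int_\Omega|\langle f,\bm{\varphi}(x)\rangle|^2\,\mathrm{d}\mu(x)\le B\|f\|^2\quad\text{for all } f\in\mathbb{K}^n,$$ and a Parseval $\mu$-frame if one can take $A=B=1$. A $\mu$-frame $\bm{\varphi}$ is called discretely scalable if there exist nodes $\{x_j\}_{j\in\mathbb{N}}\subseteq\Omega$ and scalars $\{s_j\}_{j\in\mathbb{N}}\subseteq\mathbb{K}$ such that $\{s_j\bm{\varphi}(x_j)\}_{j\in\mathbb{N}}$ is a discrete Parseval frame for $\mathbb{K}^n$, i.e. $\sum_{j}|\langle f,s_j\bm{\varphi}(x_j)\rangle|^2=\|f\|^2$ for all $f\in\mathbb{K}^n$. *)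

(* Defs.v *)
From HB Require Import structures.
From mathcomp Require Import all_boot all_order all_algebra.
From mathcomp Require Import complex.
From mathcomp Require Import all_classical all_reals all_analysis.

Set Implicit Arguments.
Unset Strict Implicit.
Unset Printing Implicit Defensive.

Import Order.TTheory GRing.Theory Num.Theory.
Import numFieldNormedType.Exports.

Local Open Scope classical_set_scope.
Local Open Scope ring_scope.

Inductive field_kind := RealField | ComplexField.

Definition base_field (R : realType) (k : field_kind) : numFieldType :=
  match k with RealField => R | ComplexField => R[i] end.

Definition bf_of_real (R : realType) (k : field_kind) : R -> base_field R k :=
  match k with
  | RealField => fun r => r
  | ComplexField => fun r => (r%:C)%C
  end.

Definition bf_conj (R : realType) (k : field_kind) : base_field R k -> base_field R k :=
  match k with
  | RealField => fun z => z
  | ComplexField => fun z => conjc z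
  end.

(* The norm of a numDomainType takes its values in the type itself; here the
   modulus is wanted as an element of R. *)
Definition bf_mod (R : realType) (k : field_kind) : base_field R k -> R :=
  match k with
  | RealField => fun z => `|z|
  | ComplexField => fun z => Normc.normc z
  end.

Definition adjoint_mx (R : realType) (k : field_kind) (m n : nat)
    (A : 'M[base_field R k]_(m, n)) : 'M[base_field R k]_(n, m) :=
  map_mx (@bf_conj R k) A^T.

Definition inner_prod (R : realType) (k : field_kind) (n : nat)
    (f g : 'cV[base_field R k]_n) : base_field R k :=
  \sum_(i < n) f i 0 * bf_conj (g i 0).

Definition normsq (R : realType) (k : field_kind) (n : nat)
    (f : 'cV[base_field R k]_n) : R :=
  \sum_(i < n) bf_mod (f i 0) ^+ 2.

Definition outer_prod (R : realType) (k : field_kind) (n : nat)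
    (v : 'cV[base_field R k]_n) : 'M[base_field R k]_n :=
  v *m adjoint_mx v.

Definition cone (R : realType) (k : field_kind) (V : lmodType (base_field R k))
    (M : set V) : set V :=
  [set u | exists (m : nat) (a : 'I_m -> R) (v : 'I_m -> V),
     [/\ forall j, 0 <= a j, forall j, M (v j) &
         u = \sum_(j < m) bf_of_real k (a j) *: v j]].

Definition lin (K : fieldType) (V : vectType K) (M : set V) : set V :=
  [set u | exists (m : nat) (a : 'I_m -> K) (v : 'I_m -> V),
     (forall j, M (v j)) /\ u = \sum_(j < m) a j *: v j].

(* [{vspace V}] only offers spans of finite sequences; [lin_vspace M] is the
   unique subspace whose carrier is [lin M], see [mem_lin_vspace]. *)
Definition lin_vspace (K : fieldType) (V : vectType K) (M : set V) :
    {vspace V} :=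
  xget 0%VS [set U : {vspace V} | forall u, u \in U <-> lin M u].

Definition dim_lin (K : fieldType) (V : vectType K) (M : set V) : nat :=
  \dim (lin_vspace M).

Lemma mem_lin_vspace (K : fieldType) (V : vectType K) (M : set V) (u : V) :
  u \in lin_vspace M <-> lin M u.
Proof.
rewrite /lin_vspace; case: xgetP => [U _ ->//|noU]; exfalso.
pose P d := `[< exists s : seq V,
  (forall v, v \in s -> M v) /\ \dim << s >>%VS = d >].
have exP : exists d, P d.
  by exists (\dim <<[::] : seq V>>%VS); apply/asboolP; exists [::].
have ubP d : P d -> (d <= \dim {:V})%N.
  by move=> /asboolP[s [_ <-]]; exact/dimvS/subvf.
case: (ex_maxnP exP ubP) => d /asboolP[s [sM ds]] dmax.
have Ms v : M v -> v \in << s >>%VS.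
  move=> Mv; have /dmax : P (\dim << v :: s >>%VS).
    apply/asboolP; exists (v :: s); split=> // w.
    by rewrite inE => /orP[/eqP->//|/sM].
  rewrite -ds => le_dim.
  have sub : (<< s >> <= << v :: s >>)%VS by rewrite span_cons addvSr.
  have /eqP -> : << s >>%VS == << v :: s >>%VS by rewrite eqEdim sub.
  by rewrite memv_span ?mem_head.
apply: (noU << s >>%VS) => w; split=> [|[m [a [v [vM ->]]]]]; last first.
  by apply: memv_suml => j _; apply/memvZ/Ms.
move=> /(coord_span (X := in_tuple s)) ->.
exists (size s), (fun i => coord (in_tuple s) i w), (fun i => s`_i).
by split=> // j; apply/sM/mem_nth.
Qed.

Definition borel_measurable (R : realType) (k : field_kind) (n : nat)
    (d : measure_display) (T : measurableType d)
    (phi : T -> 'cV[base_field R k]_n) : Prop :=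
  measurable_fun [set: T]
    (phi : T -> g_sigma_algebraType (@open 'cV[base_field R k]_n)).

Definition frame_bounds (R : realType) (k : field_kind) (n : nat)
    (d : measure_display) (T : measurableType d)
    (mu : {measure set T -> \bar R}) (phi : T -> 'cV[base_field R k]_n)
    (A B : R) : Prop :=
  forall f : 'cV[base_field R k]_n,
    ((A * normsq f)%:E <= \int[mu]_x (bf_mod (inner_prod f (phi x)) ^+ 2)%:E)%E /\
    (\int[mu]_x (bf_mod (inner_prod f (phi x)) ^+ 2)%:E <= (B * normsq f)%:E)%E.

Definition is_frame (R : realType) (k : field_kind) (n : nat)
    (d : measure_display) (T : measurableType d)
    (mu : {measure set T -> \bar R}) (phi : T -> 'cV[base_field R k]_n) : Prop :=
  borel_measurable phi /\
  exists A B : R, [/\ 0 < A, A <= B & frame_bounds mu phi A B].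

Definition is_parseval_frame (R : realType) (k : field_kind) (n : nat)
    (d : measure_display) (T : measurableType d)
    (mu : {measure set T -> \bar R}) (phi : T -> 'cV[base_field R k]_n) : Prop :=
  borel_measurable phi /\ frame_bounds mu phi 1 1.

Definition in_L2 (R : realType) (k : field_kind) (n : nat)
    (d : measure_display) (T : measurableType d)
    (mu : {measure set T -> \bar R}) (phi : T -> 'cV[base_field R k]_n) : Prop :=
  borel_measurable phi /\ (\int[mu]_x (normsq (phi x))%:E < +oo)%E.

Definition discrete_parseval_frame (R : realType) (k : field_kind) (n : nat)
    (v : nat -> 'cV[base_field R k]_n) : Prop :=
  forall f : 'cV[base_field R k]_n,
    (\sum_(0 <= j <oo) (bf_mod (inner_prod f (v j)) ^+ 2)%:E = (normsq f)%:E)%E.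

Definition discretely_scalable (R : realType) (k : field_kind) (n : nat)
    (T : Type) (phi : T -> 'cV[base_field R k]_n) : Prop :=
  exists (x : nat -> T) (s : nat -> base_field R k),
    discrete_parseval_frame (fun j => s j *: phi (x j)).

(* Only the terms of index < N of the sequences [x] and [w] matter. *)
Definition discrete_measure (R : realType) (d : measure_display)
    (T : measurableType d) (N : nat) (x : nat -> T) (w : nat -> {posnum R}) :
    {measure set T -> \bar R} :=
  msum (fun j => mscale (w j)%:num%:nng \d_(x j)) N.

(* Main.v *)
From mathcomp Require Import all_boot all_order all_algebra.
From HB Require Import structures.
From mathcomp Require Import complex.
From mathcomp Require Import all_classical all_reals all_analysis measurable_realfun.
From mathcomp Require Import ring lra.
Require Import Defs.

(** The statement rests on the identity
    [qform (outer_prod v) f = bf_mod (inner_prod f v) ^+ 2] for the quadratic form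
    [qform M f] of a matrix [M].  A Hermitian matrix is determined by its
    quadratic form, so a weighted family of vectors satisfies the Parseval
    identity exactly when the weighted sum, or integral, of its rank-one matrices
    [outer_prod v] is the identity matrix.  All the conditions are thus compared
    with condition (i), that the identity lies in the cone generated by these
    matrices.

    From (i) to the other conditions, Caratheodory's argument
    ([hermitian_caratheodory]) produces a positive combination with linearly
    independent terms, and the points and weights of this combination serve as
    nodes, squared scalars and discrete measure.  Since the matrices are
    Hermitian, a linear dependence over the base field yields a real one
    ([hermitian_real_dependence]), whence the bound by the dimension over the
    base field.

    Conversely, each of the other conditions expresses the identity matrix as an
    integral of matrices [outer_prod (phi x)], for the counting measure in the
    case of discrete scalability.  The point is that an integral in finite
    dimension belongs to the convex cone generated by the values of the
    integrand, and not merely to the closure of this cone ([integral_cone]).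
    This is proved by induction on the number of coordinates.  A vector outside a
    convex cone, closed or not, is weakly separated from it by a nonzero linear
    functional ([cone_separation]).  If the integral were outside the cone, the
    functional would be nonnegative on the integrand with nonpositive integral,
    hence would vanish almost everywhere on it, and the problem would be confined
    to a hyperplane. *)

Set Implicit Arguments.
Unset Strict Implicit.
Unset Printing Implicit Defensive.
Import Order.TTheory GRing.Theory Num.Theory.
Import numFieldNormedType.Exports.
Local Open Scope classical_set_scope.
Local Open Scope ring_scope.

(** * Separation of a point from a convex cone *)

Definition convex_cone (R : realType) (V : lmodType R) (C : set V) : Prop :=
  [/\ C 0, forall v w, C v -> C w -> C (v + w) &
      forall (c : R) v, 0 <= c -> C v -> C (c *: v)].

(** Zorn's lemma gives a cone [P] maximal among those containing [C] and
    avoiding [u].  If neither [v] nor [- v] were in [P], then by maximality [u]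
    would be in both [P + R_+ v] and [P - R_+ v], and a positive combination of
    the two expressions would put [u] in [P]. *)
Lemma maximal_cone (R : realType) (V : lmodType R) (C : set V) (u : V) :
  convex_cone C -> ~ C u ->
  exists P : set V, [/\ convex_cone P, C `<=` P, ~ P u &
    forall v, P v \/ P (- v)].
Proof.
move=> [C0 CD CZ] Cu.
(* The last clause is vacuous for the empty set, which is the union of the
   empty chain; for a nonempty [Y] it forces [C `<=` Y]. *)
pose Q (Y : set V) := [/\ ~ Y u, forall v w, Y v -> Y w -> Y (v + w),
  forall (c : R) v, 0 <= c -> Y v -> Y (c *: v) &
  forall v w, Y v -> C w -> Y (v + w)].
have [F FQ Ftot|P [PQ Pmax]] := @Zorn_bigcup _ Q.
  split=> [[Y FY Yu]|v w [Y FY Yv] [Z FZ Zw]|c v c0 [Y FY Yv]|v w [Y FY Yv] Cw].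
  - by have [/(_ Yu)] := FQ _ FY.
  - have [YZ|ZY] := Ftot _ _ FY FZ.
      by exists Z => //; have [_ + _ _] := FQ _ FZ; apply=> //; apply: YZ.
    by exists Y => //; have [_ + _ _] := FQ _ FY; apply=> //; apply: ZY.
  - by exists Y => //; have [_ _ + _] := FQ _ FY; apply.
  - by exists Y => //; have [_ _ _ +] := FQ _ FY; apply.
have [Pu PD PZ PC] := PQ.
have P0 : P 0.
  apply: contrapT => nP0.
  have Pempty v : ~ P v by move=> Pv; apply: nP0; rewrite -(scale0r v); exact: PZ.
  apply: (Pmax C) => //; split=> [v /Pempty//|].
  by apply/existsNP; exists 0 => /(_ C0).
have CP : C `<=` P by move=> v Cv; rewrite -[v]add0r; exact: PC.
have ext v : ~ P v -> exists2 p, P p & exists2 t : R, 0 <= t & u = p + t *: v.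
  move=> Pv; apply: contrapT => noext.
  apply: (Pmax [set x | exists2 p, P p & exists2 t : R, 0 <= t & x = p + t *: v]).
    split=> [p Pp|sub].
      by exists p => //; exists 0 => //; rewrite scale0r addr0.
    apply: Pv; apply: sub; exists 0 => //; exists 1; rewrite // scale1r add0r//.
  split=> //.
  - move=> _ _ [p Pp [t t0 ->]] [q Pq [s s0 ->]]; exists (p + q); first exact: PD.
    by exists (t + s); rewrite ?addr_ge0// scalerDl addrACA.
  - move=> c _ c0 [p Pp [t t0 ->]]; exists (c *: p); first exact: PZ.
    by exists (c * t); rewrite ?mulr_ge0// scalerDr scalerA.
  - move=> _ w [p Pp [t t0 ->]] Cw; exists (p + w); first exact: PC.
    by exists t; rewrite // addrAC.
exists P; split=> // v; apply: contrapT => /not_orP[/ext[p Pp [a a0 ua]]].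
move=> /ext[q Pq [b b0 ub]]; apply: Pu.
have a_gt0 : 0 < a.
  rewrite lt_neqAle a0 andbT; apply/eqP => a00.
  by have [+ _ _ _] := PQ; apply; rewrite ua -a00 scale0r addr0.
have -> : u = (a + b)^-1 *: (b *: p + a *: q).
  have -> : b *: p + a *: q = (a + b) *: u.
    have -> : p = u - a *: v by rewrite ua addrK.
    have -> : q = u + b *: v by rewrite ub scalerN subrK.
    rewrite scalerBr scalerDr !scalerA [a * b]mulrC addrACA addNr addr0.
    by rewrite addrC -scalerDl.
  by rewrite scalerA mulVf ?scale1r// gt_eqF// ltr_wpDr.
apply: (PZ); first by rewrite invr_ge0 addr_ge0.
by apply: PD; apply: (PZ).
Qed.

(** For the preorder with positive cone [P] and unit [e], the real [s] is the
    Dedekind cut of [v]: [t e <= v] for [t < s] and [v <= t e] for [s < t].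
    Stating this as a relation makes linearity in [v] immediate, without any
    manipulation of suprema. *)
Definition is_value (R : realType) (V : lmodType R) (P : set V) (e v : V)
    (s : R) : Prop :=
  (forall t, t < s -> P (v - t *: e)) /\ (forall t, s < t -> P (t *: e - v)).

Section Value.
Context (R : realType) (V : lmodType R) (P : set V) (e : V).
Context (coneP : convex_cone P) (totP : forall v, P v \/ P (- v)).
Context (eN : forall t : R, t < 0 -> ~ P (t *: e)).

Lemma is_value_sum (I : Type) (r : seq I) (v : I -> V) (s : I -> R) :
  (forall i, is_value P e (v i) (s i)) ->
  is_value P e (\sum_(i <- r) v i) (\sum_(i <- r) s i).
Proof.
have [P0 PD PZ] := coneP; move=> vs.
have valD v1 s1 v2 s2 : is_value P e v1 s1 -> is_value P e v2 s2 ->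
    is_value P e (v1 + v2) (s1 + s2).
  move=> [lt1 gt1] [lt2 gt2]; split=> t ts.
    pose h := (s1 + s2 - t) / 2; have h0 : 0 < h by rewrite divr_gt0// subr_gt0.
    have -> : t = (s1 - h) + (s2 - h) by rewrite /h; field.
    rewrite scalerDl opprD addrACA.
    by apply: PD; [apply: lt1|apply: lt2]; rewrite ltrBlDr ltrDl.
  pose h := (t - (s1 + s2)) / 2; have h0 : 0 < h by rewrite divr_gt0// subr_gt0.
  have -> : t = (s1 + h) + (s2 + h) by rewrite /h; field.
  rewrite scalerDl opprD addrACA.
  by apply: PD; [apply: gt1|apply: gt2]; rewrite ltrDl.
have val0 : is_value P e 0 0.
  suff Pe t : 0 < t -> P (t *: e).
    by split=> t t0; rewrite ?sub0r ?subr0 -?scaleNr; apply: Pe; rewrite ?oppr_gt0.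
  move=> t0; have [//|] := totP (t *: e).
  by rewrite -scaleNr => /eN; rewrite oppr_lt0 => /(_ t0).
elim: r => [|i r IHr]; first by rewrite !big_nil.
by rewrite !big_cons; apply: valD.
Qed.

Lemma is_valueN v s : is_value P e v s -> is_value P e (- v) (- s).
Proof.
move=> [lt gt]; split=> t ts; rewrite ?opprK.
  by rewrite addrC -scaleNr; apply: gt; rewrite ltrNr.
by rewrite addrC -[t]opprK scaleNr; apply: lt; rewrite ltrNl.
Qed.

Lemma is_valueZ (c : R) v s : is_value P e v s -> is_value P e (c *: v) (c * s).
Proof.
have [_ _ PZ] := coneP.
have pos (a : R) w r : 0 < a -> is_value P e w r -> is_value P e (a *: w) (a * r).
  move=> a0 [lt gt]; split=> t tr.
    rewrite -[t](mulfVK (lt0r_neq0 a0)) mulrC -scalerA -scalerBr.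
    by apply: PZ; [exact: ltW|apply: lt; rewrite ltr_pdivrMr// mulrC].
  rewrite -[t](mulfVK (lt0r_neq0 a0)) mulrC -scalerA -scalerBr.
  by apply: PZ; [exact: ltW|apply: gt; rewrite ltr_pdivlMr// mulrC].
move=> vs; have [c0|c0|->] := ltgtP c 0.
- rewrite -[c]opprK mulNr scaleNr; apply: is_valueN.
  by apply: pos; rewrite ?oppr_gt0.
- exact: pos.
- have := @is_value_sum nat [::] (fun=> v) (fun=> s).
  by rewrite !big_nil scale0r mul0r; apply.
Qed.

Lemma is_value_ge0 v s : P v -> is_value P e v s -> 0 <= s.
Proof.
have [_ PD _] := coneP; move=> Pv [_ gt].
rewrite leNgt; apply/negP => s0; apply: (@eN (s / 2)); first lra.
have -> : (s / 2) *: e = ((s / 2) *: e - v) + v by rewrite subrK.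
by apply: PD => //; apply: gt; lra.
Qed.

(** The value is the supremum of the [t] such that [t e <= v]; the order unit
    makes this set nonempty and bounded, and totality of the preorder gives
    [v <= t e] above the supremum. *)
Lemma is_value_ex v : (forall w, exists K : R, P (K *: e - w)) ->
  exists s, is_value P e v s.
Proof.
have [_ PD PZ] := coneP; move=> unit.
pose S := [set t : R | P (v - t *: e)].
have supS : has_sup S.
  split.
    have [K PK] := unit (- v); exists (- K).
    by rewrite /S /= scaleNr opprK addrC -[v]opprK.
  have [K PK] := unit v; exists K => t St.
  rewrite leNgt; apply/negP => Kt; apply: (@eN (K - t)); first by rewrite subr_lt0.
  by rewrite scalerBl -(subrK v (K *: e)) -addrA; apply: PD.
exists (sup S); split=> t ts.
  have eps0 : 0 < sup S - t by rewrite subr_gt0.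
  have [r Sr] := sup_adherent eps0 supS.
  rewrite subKr => tr.
  have [|Pn] := totP (v - t *: e); first by [].
  exfalso; apply: (@eN (t - r)); first by rewrite subr_lt0.
  by rewrite scalerBl -(subrK v (t *: e)) -addrA; apply: PD; rewrite // -opprB.
have [St|] := totP (v - t *: e); last by rewrite opprB.
by have := sup_upper_bound supS St; rewrite leNgt ts.
Qed.

End Value.

(** The cone [C] need not be closed, so the separating functional may vanish on
    part of [C], or at [u]; only [l != 0] is claimed.  After enlarging [C] to a
    cone [P] that induces a total preorder, the finite dimension provides an
    order unit: the sum of the basis vectors, each with the sign that puts it in
    [P].  The functional sends a vector to its value with respect to this
    unit. *)
Lemma cone_separation (R : realType) (m : nat) (C : set 'rV[R]_m) (u : 'rV[R]_m) :
  convex_cone C -> ~ C u ->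
  exists l : 'rV[R]_m, [/\ l != 0,
    forall v, C v -> 0 <= \sum_i v 0 i * l 0 i & \sum_i u 0 i * l 0 i <= 0].
Proof.
move=> coneC Cu; have [P [coneP CP Pu totP]] := maximal_cone coneC Cu.
have [P0 PD PZ] := coneP.
have sgn i : exists2 s : R, `|s| = 1 & P (s *: delta_mx 0 i).
  have [Pi|Pi] := totP (delta_mx 0 i); first by exists 1; rewrite ?normr1 ?scale1r.
  by exists (-1); rewrite ?normrN1 ?scaleN1r.
have [s sn Ps] : exists2 s : 'I_m -> R, forall i, `|s i| = 1 &
    forall i, P (s i *: delta_mx 0 i).
  exists (fun i => projT1 (cid2 (sgn i))) => i; by case: cid2.
pose e : 'rV[R]_m := \sum_i s i *: delta_mx 0 i.
have psum (F : 'I_m -> 'rV[R]_m) : (forall i, P (F i)) -> P (\sum_i F i).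
  by move=> PF; elim/big_ind : _.
have unit v : exists K : R, P (K *: e - v).
  exists (\sum_i `|v 0 i|); rewrite [v in _ - v]row_sum_delta /e.
  rewrite scaler_sumr -sumrB; apply: psum => i.
  set K := \sum_j _.
  have -> : K *: (s i *: delta_mx 0 i) - v 0 i *: delta_mx 0 i =
      (K - s i * v 0 i) *: (s i *: delta_mx 0 i) :> 'rV[R]_m.
    rewrite scalerBl; congr (_ - _); rewrite scalerA mulrAC.
    suff -> : s i * s i = 1 by rewrite mul1r.
    by rewrite -expr2 -real_normK ?num_real// sn expr1n.
  apply: PZ => //; rewrite subr_ge0 (le_trans (ler_norm _))// normrM sn mul1r.
  by rewrite /K (bigD1 i)//= lerDl sumr_ge0.
have eN t : t < 0 -> ~ P (t *: e).
  move=> t0 Pte; apply: Pu; have [K PK] := unit (- u).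
  have Pe s' : P (s' *: e).
    have [s0|s0] := lerP 0 s'; first by apply: PZ => //; exact: psum.
    have -> : s' = (s' / t) * t by rewrite mulfVK// lt_eqF.
    by rewrite -scalerA; apply: (PZ); rewrite // mulr_le0 ?invr_le0// ltW.
  have -> : u = (K *: e - - u) + (- K) *: e.
    by rewrite opprK scaleNr addrAC subrr add0r.
  exact: PD.
have value_delta i : exists s, is_value P e (delta_mx 0 i) s.
  exact: (is_value_ex coneP totP eN).
have [l lP] := boolp.choice value_delta.
have valv v : is_value P e v (\sum_i v 0 i * l i).
  rewrite [v in is_value _ _ v]row_sum_delta.
  by apply: is_value_sum => // i; exact: is_valueZ.
exists (\row_i l i); split.
- apply/eqP => l0.
  have [_] := valv e; under eq_bigr => i _.
    have -> : l i = 0 by move/rowP: l0 => /(_ i); rewrite !mxE.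
    rewrite mulr0; over.
  rewrite big1// => /(_ 2^-1); rewrite invr_gt0 ltr0n => /(_ isT).
  have -> : 2^-1 *: e - e = (- 2^-1 : R) *: e.
    by rewrite -[X in _ - X]scale1r -scalerBl; congr (_ *: _); field.
  by apply: eN; rewrite oppr_lt0.
- move=> v Cv; under eq_bigr do rewrite mxE.
  by apply: (is_value_ge0 coneP eN (CP _ Cv)).
- under eq_bigr do rewrite mxE.
  have [//|PNu] := totP u.
  rewrite -oppr_ge0; apply: (is_value_ge0 coneP eN PNu); exact: is_valueN.
Qed.

(** * An integral over a positive measure lies in the cone of its integrand *)

(** No closure of the cone is taken: the integral is an exact finite positive
    combination of values of [g].  The induction is on the set [A] of coordinates
    to be matched.  If [u] is not in the cone, a functional [l] separates it; then
    [l (g x)] is nonnegative on [E] with integral at most [0], hence vanishes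
    almost everywhere.  On the set where it vanishes, one coordinate in [A] is a
    linear combination of the others, both for [g] and for [u], and it can be
    dropped from [A]. *)
Lemma integral_cone (R : realType) (d : measure_display) (T : measurableType d)
    (nu : {measure set T -> \bar R}) (m : nat) (g : T -> 'rV[R]_m)
    (u : 'rV[R]_m) (A : {set 'I_m}) (E : set T) :
  measurable E ->
  (forall i, nu.-integrable E (fun x => (g x 0 i)%:E)) ->
  (forall i, i \in A -> (\int[nu]_(x in E) (g x 0 i)%:E = (u 0 i)%:E)%E) ->
  exists s : seq (R * T), (forall p, p \in s -> 0 <= p.1 /\ E p.2) /\
    forall i, i \in A -> u 0 i = \sum_(p <- s) p.1 * g p.2 0 i.
Proof.
move cA : #|A| => c; elim: c A E cA => [|c IHc] A E cA mE intg ug.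
  by exists [::]; split=> // i; rewrite (card0_eq cA).
(* Coordinates outside [A] are free in [C], which forces a functional that is
   nonnegative on [C] to depend on the coordinates in [A] only. *)
pose C : set 'rV[R]_m := [set v | exists s : seq (R * T),
  (forall p, p \in s -> 0 <= p.1 /\ E p.2) /\
  forall i, i \in A -> v 0 i = \sum_(p <- s) p.1 * g p.2 0 i].
apply: contrapT => Cu; have {Cu}Cu : ~ C u by [].
have coneC : convex_cone C.
  split.
  - by exists [::]; split=> // i _; rewrite big_nil mxE.
  - move=> v w [s [sE vs]] [t [tE wt]]; exists (s ++ t); split=> [p|i iA].
      by rewrite mem_cat => /orP[/sE|/tE].
    by rewrite big_cat/= mxE vs ?wt.
  - move=> a v a0 [s [sE vs]]; exists [seq (a * p.1, p.2) | p <- s]; split.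
      by move=> _ /mapP[p /sE[p0 Ep] ->]; rewrite mulr_ge0.
    move=> i iA; rewrite big_map mxE vs// mulr_sumr.
    by apply: eq_bigr => p _; rewrite mulrA.
have [l [l0 lC lu]] := cone_separation coneC Cu.
have lA i : i \notin A -> l 0 i = 0.
  move=> iA.
  have CZ a : C (a *: delta_mx 0 i).
    exists [::]; split=> // j jA; rewrite big_nil !mxE eqxx/=.
    by case: eqP => [ji|_]; [rewrite -ji jA in iA|rewrite mulr0].
  have lZ (a : R) : 0 <= a * l 0 i.
    have := lC _ (CZ a); rewrite (bigD1 i)//= big1 ?addr0 => [|j ji].
      by rewrite !mxE !eqxx mulr1.
    by rewrite !mxE (negbTE ji) mulr0 mul0r.
  apply/eqP; rewrite eq_le; have := lZ 1; rewrite mul1r => ->.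
  by have := lZ (-1); rewrite mulN1r oppr_ge0 => ->.
pose h x := \sum_i g x 0 i * l 0 i.
have h_ge0 x : E x -> 0 <= h x.
  move=> Ex; apply: lC; exists [:: (1, x)]; split=> [p|i _].
    by rewrite inE => /eqP ->.
  by rewrite big_seq1 mul1r.
have hE x : (h x)%:E = (\sum_i (l 0 i)%:E * (g x 0 i)%:E)%E.
  by rewrite /h -sumEFin; apply: eq_bigr => i _; rewrite mulrC EFinM.
have intlg i : nu.-integrable E (fun x => (l 0 i)%:E * (g x 0 i)%:E)%E.
  exact: integrableZl.
have inth : nu.-integrable E (EFin \o h).
  apply: (eq_integrable mE (fun x => (\sum_i (l 0 i)%:E * (g x 0 i)%:E)%E)).
    by move=> x _; rewrite /= hE.
  exact: integrable_sum.
have hu : (\int[nu]_(x in E) (h x)%:E = (\sum_i u 0 i * l 0 i)%:E)%E.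
  under eq_integral do rewrite hE.
  rewrite integral_sum// -sumEFin; apply: eq_bigr => i _.
  rewrite integralZl// mulrC EFinM.
  by have [/ug ->//|/lA ->] := boolP (i \in A); rewrite !mul0e.
have lu0 : \sum_i u 0 i * l 0 i = 0.
  apply/eqP; rewrite eq_le lu/= -lee_fin -hu.
  by apply: integral_ge0 => x Ex; rewrite lee_fin h_ge0.
have mh := measurable_int _ inth.
pose N := E `&` [set x | (h x)%:E != 0%E].
have mN : measurable N by exact: (emeasurable_neq mE mh).
have nuN : nu N = 0%E.
  have /(ae_eq_integral_abs nu mE mh) : (\int[nu]_(x in E) `|(EFin \o h) x| = 0)%E.
    under eq_integral => x /set_mem Ex do rewrite /= ger0_norm ?h_ge0//.
    by rewrite hu lu0.
  move=> [B [mB B0 sB]]; apply: measure_negligible => //; exists B; split=> //.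
  by move=> x [Ex /= /eqP hx]; apply: sB => /= /(_ Ex).
have EN : E `\` N = E `&` [set x | h x = 0].
  apply/seteqP; split=> x [Ex Nx]; split=> //.
    by apply: contrapT => hx; apply: Nx; split=> //=; rewrite eqe; exact/eqP.
  by move=> [_ /=]; rewrite Nx eqxx.
have [i0 li0] : exists i0, l 0 i0 != 0.
  apply/existsP; apply: contraR l0 => /existsPn l0.
  by apply/eqP/rowP => i; rewrite mxE; apply/eqP; move: (l0 i); rewrite negbK.
have i0A : i0 \in A by apply: contraR li0 => /lA ->.
have mEN : measurable (E `\` N) by exact: measurableD.
have [||i|s [sE us]] := IHc (A :\ i0) (E `\` N) _ mEN.
- by move: cA; rewrite (cardsD1 i0) i0A => -[].
- by move=> i; apply: (integrableS mE) => // x [].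
- rewrite in_setD1 => /andP[_ iA]; rewrite -ug//.
  by rewrite [RHS](negligible_integral mN).
apply: Cu; exists s; split=> [p /sE[p0 []]//|i iA].
have [->{i iA}|ii0] := eqVneq i i0; last by apply: us; rewrite in_setD1 ii0.
apply: (mulIf li0); rewrite mulr_suml.
transitivity (- \sum_(i | i != i0) u 0 i * l 0 i).
  by apply/eqP; move/eqP: lu0; rewrite (bigD1 i0)//= addr_eq0.
have -> : \sum_(i | i != i0) u 0 i * l 0 i =
    \sum_(p <- s) p.1 * \sum_(i | i != i0) g p.2 0 i * l 0 i.
  under [RHS]eq_bigr do rewrite mulr_sumr.
  rewrite exchange_big/=; apply: eq_bigr => i ii0.
  have [iA|/lA ->] := boolP (i \in A); last first.
    by rewrite mulr0 big1// => p _; rewrite !mulr0.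
  rewrite us ?in_setD1 ?ii0// mulr_suml.
  by apply: eq_bigr => p _; rewrite mulrA.
rewrite -sumrN; apply: eq_big_seq => p /sE[_]; rewrite EN => -[_ /= hp].
rewrite -mulrA -mulrN; congr (_ * _).
by apply/esym/eqP; move/eqP: hp; rewrite /h (bigD1 i0)//= addr_eq0.
Qed.

(** * The base field, uniformly in the two cases *)

Section BaseField.
Context (R : realType) (k : field_kind).
Local Notation K := (base_field R k).
Local Notation ofR := (@bf_of_real R k).
Local Notation conj := (@bf_conj R k).

Lemma bf_of_real_is_zmod_morphism : zmod_morphism ofR.
Proof. by case: k => // x y /=; rewrite rmorphB. Qed.

Lemma bf_of_real_is_monoid_morphism : monoid_morphism ofR.
Proof. by case: k; split=> // x y; rewrite /= rmorphM. Qed.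

Lemma bf_conj_is_zmod_morphism : zmod_morphism conj.
Proof. by case: k => // x y /=; rewrite rmorphB. Qed.

Lemma bf_conj_is_monoid_morphism : monoid_morphism conj.
Proof.
by case: k; split=> //; [exact: (rmorph1 conjc)|exact: (rmorphM conjc)].
Qed.

HB.instance Definition _ := GRing.isZmodMorphism.Build R K ofR
  bf_of_real_is_zmod_morphism.
HB.instance Definition _ := GRing.isMonoidMorphism.Build R K ofR
  bf_of_real_is_monoid_morphism.
HB.instance Definition _ := GRing.isZmodMorphism.Build K K conj
  bf_conj_is_zmod_morphism.
HB.instance Definition _ := GRing.isMonoidMorphism.Build K K conj
  bf_conj_is_monoid_morphism.

Lemma bf_conjK : involutive conj.
Proof. by case: k => // z /=; rewrite conjcK. Qed.

Lemma bf_conj_of_real r : conj (ofR r) = ofR r.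
Proof. by case: k => //; exact: (conjc_real r). Qed.

Lemma bf_normE (z : K) : `|z| = ofR (bf_mod z).
Proof. by case: k z => // -[]. Qed.

Lemma bf_mod_sqr (z : K) : ofR (bf_mod z ^+ 2) = z * conj z.
Proof.
rewrite rmorphXn /= -bf_normE; case: k z => z /=; last by rewrite sqr_normc.
by rewrite real_normK ?num_real// expr2.
Qed.

Lemma bf_of_real_inj : injective ofR.
Proof. by case: k => [x y|x y []]. Qed.

Lemma bf_of_real_lt x y : (ofR x < ofR y) = (x < y).
Proof. by case: k => //=; rewrite ltcR. Qed.

Lemma bf_modM (z w : K) : bf_mod (z * w) = bf_mod z * bf_mod w.
Proof.
by apply: bf_of_real_inj; rewrite rmorphM /= -!bf_normE normrM.
Qed.

Lemma bf_mod_conj (z : K) : bf_mod (conj z) = bf_mod z.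
Proof.
by apply: bf_of_real_inj; rewrite -!bf_normE; case: k z => //= z; rewrite normcJ.
Qed.

Lemma bf_mod_of_real r : 0 <= r -> bf_mod (ofR r) = r.
Proof.
move=> r0; apply: bf_of_real_inj; rewrite -bf_normE.
case: k => /=; first by rewrite ger0_norm.
by rewrite normc_def /= expr0n /= addr0 sqrtr_sqr ger0_norm.
Qed.

Lemma bf_mod0 : bf_mod (0 : K) = 0.
Proof. by apply: bf_of_real_inj; rewrite -bf_normE normr0 rmorph0. Qed.

Lemma bf_mod_dist (z w : K) : `|bf_mod z - bf_mod w| <= bf_mod (z - w).
Proof.
case: k z w => [z w|z w] /=; first exact: ler_dist_dist.
rewrite -lecR.
have -> : `|Normc.normc z - Normc.normc w|%:C%C = `| `|z| - `|w| |.
  rewrite [`|z|]normc_def [`|w|]normc_def -rmorphB normc_def /=.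
  by rewrite expr0n addr0 sqrtr_sqr; case: (z); case: w.
exact: ler_dist_dist.
Qed.

End BaseField.

(** * Hermitian matrices and rank-one decompositions of the identity *)

Section RankOne.
Context (R : realType) (k : field_kind) (n : nat).
Local Notation K := (base_field R k).
Local Notation ofR := (@bf_of_real R k).
Local Notation conj := (@bf_conj R k).

(** The scalars [1] and [bf_im_unit] span the base field over the reals, which
    is what testing a number for zero through real parts requires. *)
Definition bf_im_unit : K :=
  match k return base_field R k with RealField => 1 | ComplexField => ('i)%C end.

Lemma bf_re_im_eq0 (z : K) :
  z + conj z = 0 -> z * bf_im_unit + conj (z * bf_im_unit) = 0 -> z = 0.
Proof.
rewrite /bf_im_unit; case: k z => [z|[a b]] /=.
  by move=> zz _; lra.
move=> /eqP; rewrite eq_complex /= => /andP[/eqP a0 _].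
move=> /eqP; rewrite eq_complex /= => /andP[/eqP b0 _].
by apply/eqP; rewrite eq_complex /=; apply/andP; split; apply/eqP; lra.
Qed.

Lemma bf_add_conj_real (z : K) : exists r : R, z + conj z = ofR r.
Proof.
case: k z => [z|[a b]] /=; first by exists (z + z).
by exists (a + a); apply/eqP; rewrite eq_complex /= subrr !eqxx.
Qed.

Lemma adjoint_mxM (m p q : nat) (A : 'M[K]_(m, p)) (B : 'M[K]_(p, q)) :
  adjoint_mx (A *m B) = adjoint_mx B *m adjoint_mx A.
Proof. by rewrite /adjoint_mx trmx_mul map_mxM. Qed.

Lemma adjoint_mxK (m p : nat) (A : 'M[K]_(m, p)) :
  adjoint_mx (adjoint_mx A) = A.
Proof. by apply/matrixP => i j; rewrite !mxE bf_conjK. Qed.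

Lemma adjoint_outer_prod (v : 'cV[K]_n) :
  adjoint_mx (outer_prod v) = outer_prod v.
Proof. by rewrite adjoint_mxM adjoint_mxK. Qed.

Lemma outer_prodZ (s : K) (v : 'cV[K]_n) :
  outer_prod (s *: v) = ofR (bf_mod s ^+ 2) *: outer_prod v.
Proof.
rewrite /outer_prod bf_mod_sqr.
have -> : adjoint_mx (s *: v) = conj s *: adjoint_mx v.
  by apply/matrixP => i j; rewrite !mxE rmorphM.
by rewrite -scalemxAl -scalemxAr scalerA.
Qed.

Lemma inner_prodZr (s : K) (f v : 'cV[K]_n) :
  inner_prod f (s *: v) = conj s * inner_prod f v.
Proof.
rewrite /inner_prod mulr_sumr; apply: eq_bigr => i _.
by rewrite mxE rmorphM mulrCA.
Qed.

Lemma inner_prodE (f v : 'cV[K]_n) : inner_prod f v = (adjoint_mx v *m f) 0 0.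
Proof. by rewrite mxE; apply: eq_bigr => i _; rewrite !mxE mulrC. Qed.

Lemma conj_inner_prod (f v : 'cV[K]_n) :
  conj (inner_prod f v) = (adjoint_mx f *m v) 0 0.
Proof.
rewrite /inner_prod rmorph_sum mxE; apply: eq_bigr => i _.
by rewrite !mxE rmorphM /= bf_conjK.
Qed.

Definition qform (M : 'M[K]_n) (f : 'cV[K]_n) : K := (adjoint_mx f *m M *m f) 0 0.

Lemma qform_outer_prod (f v : 'cV[K]_n) :
  qform (outer_prod v) f = ofR (bf_mod (inner_prod f v) ^+ 2).
Proof.
rewrite bf_mod_sqr /qform /outer_prod !mulmxA -mulmxA mxE big_ord1.
by rewrite -conj_inner_prod -inner_prodE mulrC.
Qed.

Lemma qform1 (f : 'cV[K]_n) : qform 1%:M f = ofR (normsq f).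
Proof.
rewrite /qform mulmx1 mxE rmorph_sum; apply: eq_bigr => i _.
by rewrite !mxE /= bf_mod_sqr mulrC.
Qed.

Lemma qform_sum (J : Type) (r : seq J) (a : J -> R) (v : J -> 'cV[K]_n) f :
  qform (\sum_(j <- r) ofR (a j) *: outer_prod (v j)) f =
  ofR (\sum_(j <- r) a j * bf_mod (inner_prod f (v j)) ^+ 2).
Proof.
rewrite /qform mulmx_sumr mulmx_suml summxE rmorph_sum; apply: eq_bigr => j _.
by rewrite -scalemxAr -scalemxAl mxE -/(qform _ _) qform_outer_prod rmorphM.
Qed.

Lemma qform_delta (M : 'M[K]_n) (c : K) (i j : 'I_n) :
  qform M (delta_mx i 0 + c *: delta_mx j 0) =
  M i i + c * M i j + conj c * (M j i + c * M j j).
Proof.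
rewrite /qform.
have -> : adjoint_mx (delta_mx i 0 + c *: delta_mx j 0) =
    delta_mx 0 i + conj c *: delta_mx 0 j :> 'rV[K]_n.
  apply/matrixP => a b; rewrite !mxE rmorphD rmorphM !rmorph_nat.
  by rewrite ![_ && (a == 0)]andbC [(a == 0) && _]andbC.
rewrite mulmxDl -scalemxAl -!rowE mulmxDr -!scalemxAr.
rewrite -!colE !mxE; ring.
Qed.

(** A Hermitian matrix is determined by finitely many values of its quadratic
    form: those at [e_i + c e_j] with [c] equal to [1] or [bf_im_unit].  The case
    [i = j] gives the diagonal, and then the two choices of [c] give the real and
    imaginary parts of the entry [M i j]. *)
Lemma hermitian_polarization :
  exists F : seq 'cV[K]_n, forall M : 'M[K]_n, adjoint_mx M = M ->
    (forall f, f \in F -> qform M f = 0) -> M = 0.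
Proof.
pose t (p : 'I_n * 'I_n * bool) : 'cV[K]_n :=
  delta_mx p.1.1 0 + (if p.2 then 1 else bf_im_unit) *: delta_mx p.1.2 0.
exists [seq t p | p <- enum {: 'I_n * 'I_n * bool}] => M hM MF.
have Mt p : qform M (t p) = 0 by by apply: MF; rewrite map_f ?mem_enum.
have Mc i j : M j i = conj (M i j) by rewrite -[in LHS]hM !mxE.
have Mii i : M i i = 0.
  have := Mt (i, i, true); rewrite /t /= qform_delta rmorph1 !mul1r => M4.
  apply/eqP; have /eqP := M4.
  by rewrite -!mulr2n !mulrn_eq0.
apply/matrixP => i j; rewrite mxE; apply: bf_re_im_eq0.
  have := Mt (i, j, true).
  by rewrite /t /= qform_delta !Mii rmorph1 !mul1r add0r addr0 -Mc.
have := Mt (i, j, false).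
rewrite /t /= qform_delta !Mii mulr0 add0r addr0 rmorphM /= -Mc => <-.
by rewrite mulrC [M j i * _]mulrC.
Qed.

(** Finitely many instances of the Parseval identity already imply that the
    rank-one matrices sum to the identity, which reduces the matrix equation to
    finitely many real-valued ones. *)
Lemma rank_one_decomposition :
  exists F : seq 'cV[K]_n,
  forall (J : Type) (r : seq J) (a : J -> R) (v : J -> 'cV[K]_n),
  (forall f, f \in F ->
    normsq f = \sum_(j <- r) a j * bf_mod (inner_prod f (v j)) ^+ 2) ->
  1%:M = \sum_(j <- r) ofR (a j) *: outer_prod (v j).
Proof.
have [F FP] := hermitian_polarization.
exists F => J r a v Fv; apply/eqP; rewrite -subr_eq0; apply/eqP/FP.
  apply/matrixP => i j; rewrite !mxE !summxE rmorphB rmorph_sum rmorph_nat eq_sym.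
  congr (_ - _); apply: eq_bigr => p _.
  rewrite [in LHS]mxE rmorphM /= bf_conj_of_real [in RHS]mxE.
  by rewrite -[in RHS]adjoint_outer_prod [in RHS]mxE [in RHS]mxE.
move=> f /Fv fv; rewrite /qform mulmxBr mulmxBl mxE [X in _ + X]mxE.
by rewrite -!/(qform _ _) qform1 qform_sum fv subrr.
Qed.

(** Taking adjoints, [conj c] is a dependence whenever [c] is; hence so are the
    real parts of [c] and of [c * bf_im_unit], and they are not both zero.  This
    is why the number of points can be bounded by the dimension over the base
    field, although the weights are real. *)
Lemma hermitian_real_dependence (m : nat) (H : 'I_m -> 'M[K]_n) (c : 'I_m -> K) :
  (forall j, adjoint_mx (H j) = H j) -> \sum_j c j *: H j = 0 ->
  (exists j, c j != 0) ->
  exists2 r : 'I_m -> R, \sum_j ofR (r j) *: H j = 0 & exists j, r j != 0.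
Proof.
move=> hH c0 [j0 cj0].
have herm (b : 'I_m -> K) : \sum_j b j *: H j = 0 ->
    \sum_j (b j + conj (b j)) *: H j = 0.
  move=> b0; under eq_bigr do rewrite scalerDl; rewrite big_split/= b0 add0r.
  have := congr1 (@adjoint_mx R k n n) b0.
  have -> : adjoint_mx (0 : 'M[K]_n) = 0.
    by apply/matrixP => i j; rewrite !mxE rmorph0.
  move=> aS0; rewrite -[RHS]aS0; apply/matrixP => i j.
  rewrite !mxE !summxE rmorph_sum.
  by apply: eq_bigr => p _; rewrite -[in LHS]hH !mxE rmorphM.
have [r rP] := boolp.choice (fun j => bf_add_conj_real (c j)).
have [r' r'P] := boolp.choice (fun j => bf_add_conj_real (c j * bf_im_unit)).
have [rj0|rj0] := eqVneq (r j0) 0; last first.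
  exists r; last by exists j0.
  by rewrite -[RHS](herm _ c0); apply: eq_bigr => j _; rewrite rP.
exists r'.
  under eq_bigr do rewrite -r'P.
  apply: herm; under eq_bigr do rewrite mulrC -scalerA.
  by rewrite -scaler_sumr c0 scaler0.
exists j0; apply: contraNneq cj0 => r'j0; apply/eqP/bf_re_im_eq0.
  by rewrite rP rj0 rmorph0.
by rewrite r'P r'j0 rmorph0.
Qed.

(** In a representation of [u] with the fewest terms, all weights are positive,
    since a term of weight zero could be dropped.  The matrices are moreover
    linearly independent: otherwise, subtracting a suitable multiple of a real
    dependence kills one weight while keeping the others nonnegative. *)
Lemma hermitian_caratheodory (T : Type) (g : T -> 'M[K]_n) (u : 'M[K]_n) :
  (forall x, adjoint_mx (g x) = g x) -> cone (range g) u ->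
  exists2 N, (N <= dim_lin (range g))%N &
  exists (x : 'I_N -> T) (w : 'I_N -> R), (forall j, 0 < w j) /\
    u = \sum_j ofR (w j) *: g (x j).
Proof.
move=> hg [m0 [a0 [v0 [a0_ge0 gv0 uE]]]].
pose P m := `[< exists (x : 'I_m -> T) (a : 'I_m -> R), (forall j, 0 <= a j) /\
  u = \sum_j ofR (a j) *: g (x j) >].
have exP : exists m, P m.
  have gx j : exists x, g x = v0 j by have [x _ <-] := gv0 j; exists x.
  have [x xP] := boolp.choice gx.
  exists m0; apply/asboolP; exists x, a0; split=> //.
  by rewrite uE; apply: eq_bigr => j _; rewrite xP.
case: (ex_minnP exP) => N /asboolP[x [a [a_ge0 {}uE]]] Nmin.
have a_neq0 (b : 'I_N -> R) : (forall j, 0 <= b j) ->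
    u = \sum_j ofR (b j) *: g (x j) -> forall j, b j != 0.
  case: N x {a a_ge0 uE} b Nmin => [|N] x b Nmin b_ge0 uE j; first by case: j.
  apply/negP => /eqP bj0.
  suff /Nmin : P N by rewrite ltnn.
  apply/asboolP; exists (fun i => x (lift j i)), (fun i => b (lift j i)).
  by split=> //; rewrite uE (bigD1_ord j)//= bj0 rmorph0 scale0r add0r.
have Xfree : free [tuple g (x j) | j < N].
  apply/freeP => c; under eq_bigr do rewrite -tnth_nth tnth_mktuple.
  move=> c0 j; apply/eqP; apply: contrapT => /negP cj.
  have [||r r0 [i ri]] := @hermitian_real_dependence N (fun j => g (x j)) c _ c0.
  - by move=> i; exact: hg.
  - by exists j.
  wlog {ri} ri : r r0 / 0 < r i.
    move=> W; have [r_lt0|r_gt0|rE] := ltgtP (r i) 0.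
    - apply: (W (fun i => - r i)); rewrite ?oppr_gt0//.
      by under eq_bigr do rewrite rmorphN scaleNr; rewrite sumrN r0 oppr0.
    - exact: W r_gt0.
    - by rewrite rE eqxx in ri.
  case: (@Order.TotalTheory.arg_minP _ _ _ i (fun i => 0 < r i)
    (fun i => a i / r i) ri).
  (* The largest [t] such that all the weights [a j - t * r j] stay
     nonnegative: the weight of index [l] becomes zero. *)
  move=> l rl lmin; set t := a l / r l.
  have t_ge0 : 0 <= t by rewrite divr_ge0// ltW.
  have /(_ _ _ l)/eqP := a_neq0 (fun j => a j - t * r j); apply.
  - move=> p; rewrite subr_ge0; have [rp|rp] := lerP (r p) 0.
      by rewrite (le_trans _ (a_ge0 p))// mulr_ge0_le0.
    by rewrite -ler_pdivlMr// lmin.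
  - under eq_bigr do rewrite rmorphB rmorphM scalerBl -scalerA.
    by rewrite sumrB -uE -scaler_sumr r0 scaler0 subr0.
  - by rewrite /t mulfVK ?subrr// gt_eqF.
exists N; last first.
  exists x, a; split=> // j; rewrite lt_neqAle a_ge0 andbT eq_sym.
  exact: a_neq0.
move: Xfree; rewrite /free size_tuple => /eqP <-; apply: dimvS.
apply/span_subvP => _ /tnthP[j ->]; rewrite tnth_mktuple; apply/mem_lin_vspace.
exists 1, (fun=> 1), (fun=> g (x j)); split=> [_|]; first by exists (x j).
by rewrite big_ord1 scale1r.
Qed.

End RankOne.

(** * Measurability of the frame coefficients *)

Section Continuity.
Context (R : realType) (k : field_kind) (n : nat).
Local Notation K := (base_field R k).

Lemma bf_conj_continuous : continuous (@bf_conj R k).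
Proof.
move=> z; apply/(@cvgrPdist_lt _ _ _ (nbhs (z : K))) => e e0; near=> w.
rewrite -rmorphB /= bf_normE bf_mod_conj -bf_normE; near: w.
exact: cvgr_dist_lt.
Unshelve. all: by end_near. Qed.

Lemma bf_mod_continuous : continuous (@bf_mod R k).
Proof.
move=> z; apply/(@cvgrPdist_lt _ _ _ (nbhs z)) => e e0; near=> w.
apply: le_lt_trans (bf_mod_dist _ _) _.
rewrite -(bf_of_real_lt k) -bf_normE; near: w.
have ofe0 : 0 < bf_of_real k e.
  by rewrite -(rmorph0 (@bf_of_real R k)) bf_of_real_lt.
exact: cvgr_dist_lt.
Unshelve. all: by end_near. Qed.

Lemma inner_prod_continuous (f : 'cV[K]_n) : continuous (inner_prod f).
Proof.
rewrite /inner_prod; apply: continuous_big => [|i _]; first exact: add_continuous.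
move=> v; have conj_coord :
    (fun w : 'cV[K]_n => bf_conj (w i 0)) @ v --> bf_conj (v i 0).
  apply: (cvg_comp _ _ (@coord_continuous K n 1 i 0 v)).
  exact: bf_conj_continuous.
by apply: cvgM conj_coord; exact: cvg_cst.
Qed.

Lemma frame_coef_continuous (f : 'cV[K]_n) :
  continuous (fun v => bf_mod (inner_prod f v) ^+ 2 : R).
Proof.
move=> v.
have bfc : (fun v => bf_mod (inner_prod f v)) @ v --> bf_mod (inner_prod f v).
  apply: (cvg_comp _ _ (@inner_prod_continuous f v)).
  exact: bf_mod_continuous.
by apply: (cvg_comp _ (fun x : R => x ^+ 2) bfc); exact: exprn_continuous.
Qed.

Lemma normsq_continuous : continuous (@normsq R k n).
Proof.
rewrite /normsq; apply: continuous_big => [|i _]; first exact: add_continuous.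
move=> v; have mod_coord :
    (fun w : 'cV[K]_n => bf_mod (w i 0)) @ v --> bf_mod (v i 0).
  apply: (cvg_comp _ _ (@coord_continuous K n 1 i 0 v)).
  exact: bf_mod_continuous.
by apply: (cvg_comp _ (fun x : R => x ^+ 2) mod_coord); exact: exprn_continuous.
Qed.

End Continuity.

Lemma borel_measurable_continuous_comp (R : realType) (k : field_kind) (n : nat)
    (d : measure_display) (T : measurableType d)
    (phi : T -> 'cV[base_field R k]_n) (h : 'cV[base_field R k]_n -> R) :
  borel_measurable phi -> continuous h ->
  measurable_fun [set: T] (h \o phi).
Proof.
move=> mphi /continuousP hc.
apply: (measurability _ (RGenOpens.measurableE R)) => _ [_ [a [b ->] <-]].
rewrite comp_preimage; apply: mphi => //; apply: sub_sigma_algebra.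
apply: hc; exact: interval_open.
Qed.

Lemma measurable_frame_coef (R : realType) (k : field_kind) (n : nat)
    (d : measure_display) (T : measurableType d)
    (phi : T -> 'cV[base_field R k]_n) (f : 'cV[base_field R k]_n) :
  borel_measurable phi ->
  measurable_fun [set: T] (fun x => (bf_mod (inner_prod f (phi x)) ^+ 2)%:E).
Proof.
move=> mphi; apply/measurable_EFinP.
exact: (borel_measurable_continuous_comp mphi (@frame_coef_continuous R k n f)).
Qed.

(** * Parseval frames and decompositions of the identity *)

Section Parseval.
Context (R : realType) (k : field_kind) (n : nat).
Local Notation K := (base_field R k).
Local Notation ofR := (@bf_of_real R k).

(** The Parseval identity at a vector [f] says that the integral of
    [qform (outer_prod (phi x)) f] is [qform 1%:M f].  Finitely many [f] determine a
    Hermitian matrix, so [integral_cone] applies to the corresponding finite list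
    of coordinates. *)
Lemma parseval_integral_cone (d : measure_display) (T : measurableType d)
    (nu : {measure set T -> \bar R}) (phi : T -> 'cV[K]_n) :
  (forall f, measurable_fun [set: T]
     (fun x => (bf_mod (inner_prod f (phi x)) ^+ 2)%:E)) ->
  (forall f, (\int[nu]_x (bf_mod (inner_prod f (phi x)) ^+ 2)%:E =
     (normsq f)%:E)%E) ->
  cone (range (fun x => outer_prod (phi x))) 1%:M.
Proof.
move=> mphi intphi; have [F FP] := rank_one_decomposition R k n.
pose g x : 'rV[R]_(size F) := \row_i bf_mod (inner_prod F`_i (phi x)) ^+ 2.
pose u : 'rV[R]_(size F) := \row_i normsq F`_i.
have intg i : (\int[nu]_x (g x 0 i)%:E = (u 0 i)%:E)%E.
  by rewrite mxE -intphi; apply: eq_integral => x _; rewrite mxE.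
have mg i : measurable_fun [set: T] (fun x => (g x 0 i)%:E).
  by under eq_fun do rewrite mxE; exact: mphi.
have [||i _|s [s_ge0 us]] := @integral_cone R d T nu _ g u [set: _]%SET setT.
- exact: measurableT.
- move=> i; apply/integrableP; split; first exact: mg.
  under eq_integral => x _.
    rewrite gee0_abs; last by rewrite lee_fin mxE sqr_ge0.
    over.
  by rewrite intg ltry.
- exact: intg.
have one := FP _ s fst (fun p => phi p.2).
exists (size s), (fun j => (tnth (in_tuple s) j).1),
  (fun j => outer_prod (phi (tnth (in_tuple s) j).2)); split.
- by move=> j; have [] := s_ge0 _ (mem_tnth j (in_tuple s)).
- by move=> j; exists (tnth (in_tuple s) j).2.
transitivity (\sum_(p <- s) ofR p.1 *: outer_prod (phi p.2)); last exact: big_tnth.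
apply: one => f fF.
have iF : (index f F < size F)%N by rewrite index_mem.
have := us (Ordinal iF); rewrite inE !mxE /= nth_index// => -> //.
by apply: eq_bigr => p _; rewrite mxE /= nth_index.
Qed.

Lemma frame_bounds1 (d : measure_display) (T : measurableType d)
    (nu : {measure set T -> \bar R}) (phi : T -> 'cV[K]_n) :
  frame_bounds nu phi 1 1 <->
  forall f, (\int[nu]_x (bf_mod (inner_prod f (phi x)) ^+ 2)%:E =
     (normsq f)%:E)%E.
Proof.
split=> [bnd f|eqf f]; last by rewrite eqf mul1r.
by apply/eqP; have [] := bnd f; rewrite mul1r eq_le => -> ->.
Qed.

Lemma parseval_frame_cone (d : measure_display) (T : measurableType d)
    (nu : {measure set T -> \bar R}) (phi : T -> 'cV[K]_n) :
  is_parseval_frame nu phi -> cone (range (fun x => outer_prod (phi x))) 1%:M.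
Proof.
move=> [mphi /frame_bounds1 intphi]; apply: parseval_integral_cone intphi => f.
exact: measurable_frame_coef.
Qed.

(** A series is an integral for the counting measure on the index set, so the
    result on integrals applies to the scaled vectors; the squared moduli of the
    scalars are then absorbed in the weights. *)
Lemma discretely_scalable_cone (T : Type) (phi : T -> 'cV[K]_n) :
  discretely_scalable phi -> cone (range (fun x => outer_prod (phi x))) 1%:M.
Proof.
move=> [x [s parseval]].
have [||m [a [v [a_ge0 vP ->]]]] := @parseval_integral_cone _ nat counting
  (fun j => s j *: phi (x j)).
- by [].
- move=> f; rewrite ge0_integral_count// -?parseval// => j.
  by rewrite lee_fin sqr_ge0.
have vP' i : exists j, outer_prod (s j *: phi (x j)) = v i.
  by have [j _ <-] := vP i; exists j.
have [j jP] := boolp.choice vP'.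
exists m, (fun i => a i * bf_mod (s (j i)) ^+ 2),
  (fun i => outer_prod (phi (x (j i)))); split.
- by move=> i; rewrite mulr_ge0// sqr_ge0.
- by move=> i; exists (x (j i)).
- by apply: eq_bigr => i _; rewrite -jP outer_prodZ scalerA [in RHS]rmorphM.
Qed.

Lemma cone_decomposition (T : pointedType) (phi : T -> 'cV[K]_n) :
  cone (range (fun x => outer_prod (phi x))) 1%:M ->
  exists2 N, (N <= dim_lin (range (fun x => outer_prod (phi x))))%N &
  exists (x : nat -> T) (w : nat -> {posnum R}),
    1%:M = \sum_(j < N) ofR (w j)%:num *: outer_prod (phi (x j)).
Proof.
move=> /hermitian_caratheodory[x|N Ndim [x [w [w_gt0 one]]]].
  exact: adjoint_outer_prod.
exists N => //.
exists (fun j => if insub j is Some i then x i else point).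
exists (fun j => if insub j is Some i then PosNum (w_gt0 i) else 1%:pos).
by rewrite one; apply: eq_bigr => j _; rewrite valK.
Qed.

Lemma decomposition_normsq (T : Type) (phi : T -> 'cV[K]_n) N (x : nat -> T)
    (w : nat -> {posnum R}) (f : 'cV[K]_n) :
  1%:M = \sum_(j < N) ofR (w j)%:num *: outer_prod (phi (x j)) ->
  normsq f = \sum_(j < N) (w j)%:num * bf_mod (inner_prod f (phi (x j))) ^+ 2.
Proof.
move=> one; apply: (@bf_of_real_inj _ k).
by rewrite -qform1 one (qform_sum _ _ (fun j : 'I_N => phi (x j))).
Qed.

Lemma decomposition_discretely_scalable (T : Type) (phi : T -> 'cV[K]_n) N
    (x : nat -> T) (w : nat -> {posnum R}) :
  1%:M = \sum_(j < N) ofR (w j)%:num *: outer_prod (phi (x j)) ->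
  discretely_scalable phi.
Proof.
(* The sequence of scalars is extended by zero beyond the [N] nodes. *)
move=> one; pose s j := if (j < N)%N then ofR (Num.sqrt (w j)%:num) else 0.
exists x, s => f.
have coefE j : bf_mod (inner_prod f (s j *: phi (x j))) ^+ 2 =
    bf_mod (s j) ^+ 2 * bf_mod (inner_prod f (phi (x j))) ^+ 2.
  by rewrite inner_prodZr bf_modM bf_mod_conj exprMn.
rewrite (nneseries_split 0 N) => [|j _]; last by rewrite lee_fin sqr_ge0.
rewrite eseries0 => [|j Nj _]; last first.
  by rewrite coefE /s add0n in Nj *; rewrite ltnNge Nj /= bf_mod0 expr0n mul0r.
rewrite adde0 add0n big_mkord sumEFin
  (@decomposition_normsq T phi N x w f one).
congr (_%:E); apply: eq_bigr => j _.
by rewrite coefE /s ltn_ord bf_mod_of_real ?sqrtr_ge0// sqr_sqrtr.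
Qed.

Lemma integral_discrete_measure (d : measure_display) (T : measurableType d)
    (N : nat) (x : nat -> T) (w : nat -> {posnum R}) (h : T -> R) :
  (forall y, 0 <= h y) -> measurable_fun [set: T] (fun y => (h y)%:E) ->
  (\int[discrete_measure N x w]_y (h y)%:E =
   (\sum_(j < N) (w j)%:num * h (x j))%:E)%E.
Proof.
move=> h0 mh; rewrite /discrete_measure ge0_integral_measure_sum//=; last first.
  by move=> y _; rewrite lee_fin.
rewrite -sumEFin; apply: eq_bigr => j _.
rewrite ge0_integral_mscale//; last by move=> y _; rewrite lee_fin.
by rewrite integral_dirac// diracT mul1e EFinM.
Qed.

Lemma decomposition_parseval_frame (d : measure_display) (T : measurableType d)
    (phi : T -> 'cV[K]_n) (N : nat) (x : nat -> T) (w : nat -> {posnum R}) :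
  borel_measurable phi ->
  1%:M = \sum_(j < N) ofR (w j)%:num *: outer_prod (phi (x j)) ->
  is_parseval_frame (discrete_measure N x w) phi.
Proof.
move=> mphi one; split=> //; apply/frame_bounds1 => f.
rewrite (@decomposition_normsq T phi N x w f one) integral_discrete_measure//.
- by move=> y; rewrite sqr_ge0.
- exact: measurable_frame_coef.
Qed.

Lemma discrete_measure_in_L2 (d : measure_display) (T : measurableType d)
    (phi : T -> 'cV[K]_n) (N : nat) (x : nat -> T) (w : nat -> {posnum R}) :
  borel_measurable phi -> in_L2 (discrete_measure N x w) phi.
Proof.
move=> mphi; split=> //; rewrite integral_discrete_measure ?ltry//.
- by move=> y; apply: sumr_ge0 => i _; rewrite sqr_ge0.
- apply/measurable_EFinP.
  exact: (borel_measurable_continuous_comp mphi (@normsq_continuous R k n)).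
Qed.

End Parseval.

Theorem corollary6p9 (R : realType) (k : field_kind) (n : nat)
    (d : measure_display) (Omega : measurableType d)
    (mu : {measure set Omega -> \bar R})
    (phi : Omega -> 'cV[base_field R k]_n) (hphi : is_frame mu phi) :
  [/\ discretely_scalable phi <->
        cone (range (fun x => outer_prod (phi x))) 1%:M,
      discretely_scalable phi <->
        (exists Sigma : set (set Omega), sigma_algebra [set: Omega] Sigma /\
         exists nu : {measure set (g_sigma_algebraType Sigma) -> \bar R},
           in_L2 nu phi /\ is_parseval_frame nu phi) &
      discretely_scalable phi <->
        (exists N : nat,
           (N <= dim_lin (range (fun x => outer_prod (phi x))))%N /\
         exists (x : nat -> Omega) (w : nat -> {posnum R}),
           is_parseval_frame (discrete_measure N x w) phi)].
Proof.
have [mphi _] := hphi.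
have cone_scalable : cone (range (fun x => outer_prod (phi x))) 1%:M ->
    discretely_scalable phi.
  move=> /cone_decomposition[N _ [x [w one]]].
  exact: (@decomposition_discretely_scalable R k n Omega phi N x w one).
split; split.
- exact: discretely_scalable_cone.
- exact: cone_scalable.
- move=> /discretely_scalable_cone/cone_decomposition[N _ [x [w one]]].
  (* The sigma-algebra generated by the measurable sets is a different type from
     [Omega], so that the measurability of [phi] has to be transferred. *)
  exists (@measurable d Omega); split; first exact: sigma_algebra_measurable.
  have mphi' : @borel_measurable R k n _
      (g_sigma_algebraType (@measurable d Omega)) phi.
    move=> _ Y mY; apply: sub_sigma_algebra; exact: mphi.
  exists (discrete_measure N (x : nat -> g_sigma_algebraType measurable) w).
  by split; [exact: discrete_measure_in_L2|exact: decomposition_parseval_frame].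
- move=> [Sigma [_ [nu [_ /parseval_frame_cone]]]]; exact: cone_scalable.
- move=> /discretely_scalable_cone/cone_decomposition[N Ndim [x [w one]]].
  exists N; split=> //; exists x, w; exact: decomposition_parseval_frame.
- move=> [N [_ [x [w /parseval_frame_cone]]]]; exact: cone_scalable.
Qed.
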